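(* Let $(A,\succ,\prec)$ be an anti-dendriform algebra and $r\in A\otimes A$. Assume that $s=r+\tau(r)$ is invariant. Define operations on $A^*$ by $$\zeta\succeq_{s}\eta=L_{\prec}^{*}(T_{s}(\eta))\zeta,\qquad \zeta\preceq_{s}\eta=-L_{\cdot}^{*}(T_{s}(\eta))\zeta,\qquad \zeta\cdot_{s}\eta=-L_{\succ}^{*}(T_{s}(\eta))\zeta .$$ Then the following conditions are equivalent. (a) $r$ is a solution of the AD-YBE in $(A,\succ,\prec)$ such that $(A,\succ,\prec,\Delta_{\succ,r},\Delta_{\prec,r})$, with $\Delta_{\succ,r}(x)=-(R_{\prec}(x)\otimes I+I\otimes L_{\cdot}(x))r$ and $\Delta_{\prec,r}(x)=(R_{\cdot}(x)\otimes I+I\otimes L_{\succ}(x))r$, is a quasi-triangular anti-dendriform bialgebra. (b) $T_r$ is a relative Rota-Baxter operator of weight $-1$ on $(A,\succ,\prec)$ associated with the $A$-anti-dendriform algebra $(A^{*},\succeq_{s},\preceq_{s},-R_{\cdot}^{*},L_{\prec}^{*},R_{\succ}^{*},-L_{\cdot}^{*})$, that is, for all $\zeta,\eta\in A^*$, $$T_{r}(\zeta)\succ T_{r}(\eta)= T_{r}\big(-R_{\cdot}^{*}(T_{r}(\zeta))\eta+L_{\prec}^{*}(T_{r}(\eta))\zeta-\zeta\succeq_{s}\eta\big),$$ $$T_{r}(\zeta)\prec T_{r}(\eta)=T_{r}\big(R_{\succ}^{*}(T_{r}(\zeta))\eta-L_{\cdot}^{*}(T_{r}(\eta))\zeta-\zeta\preceq_{s}\eta\big).$$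 (c) $T_r$ is a relative Rota-Baxter operator of weight $-1$ on $(A,\cdot)$ associated with the $A$-associative algebra $(A^{*},\cdot_{s},-R_{\prec}^{*},-L_{\succ}^{*})$, that is, for all $\zeta,\eta\in A^*$, $$T_{r}(\zeta)\cdot T_{r}(\eta)= T_{r}\big(-R_{\prec}^{*}(T_{r}(\zeta))\eta-L_{\succ}^{*}(T_{r}(\eta))\zeta-\zeta\cdot_{s}\eta\big).$$
   Context: All vector spaces are finite-dimensional over a field $k$. An anti-dendriform algebra is a vector space $A$ with bilinear operations $\succ,\prec$ such that, writing $x\cdot y=x\succ y+x\prec y$, for all $x,y,z$: $x\succ(y\succ z)=-(x\cdot y)\succ z=-x\prec(y\cdot z)=(x\prec y)\prec z$ and $(x\succ y)\prec z=x\succ(y\prec z)$; then $(A,\cdot)$ is associative. For $\ast\in\{\succ,\prec,\cdot\}$: $L_\ast(x)y=x\ast y$, $R_\ast(x)y=y\ast x$. $\tau$ is the flip; $I$ is the identity. For $f:A\to\mathrm{End}(V)$, $f^*:A\to\mathrm{End}(V^* )$ is $\langle f^*(x)u^*,v\rangle=\langle u^*,f(x)v\rangle$ (no sign). For $r\in A\otimes A$, $T_r:A^*\to A$ is defined by $\langle T_r(\zeta),\eta\rangle=\langle r,\zeta\otimes\eta\rangle$. Invariance: $s\in A\otimes A$ is invariant if $(R_{\prec}(x)\otimes I+I\otimes L_{\cdot}(x))s=0$ and $(R_{\cdot}(x)\otimes I+I\otimes L_{\succ}(x))s=0$ for all $x\in A$. AD-YBE: for $r=\sum_i a_i\otimes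 b_i$, $\sum_{i,j}\big(a_i\cdot a_j\otimes b_i\otimes b_j+a_j\otimes (a_i\succ b_j)\otimes b_i-a_i\otimes a_j\otimes (b_i\prec b_j)\big)=0$. Anti-dendriform bialgebra: a quintuple $(A,\succ,\prec,\Delta_\succ,\Delta_\prec)$ where $(A,\succ,\prec)$ is an anti-dendriform algebra; $\Delta_\succ,\Delta_\prec:A\to A\otimes A$ are linear maps such that the operations on $A^*$ given by $\langle x,\zeta\succ_{A^*}\eta\rangle=\langle\Delta_\succ(x),\zeta\otimes\eta\rangle$, $\langle x,\zeta\prec_{A^*}\eta\rangle=\langle\Delta_\prec(x),\zeta\otimes\eta\rangle$ make $A^*$ an anti-dendriform algebra; and, with $\Delta=\Delta_\succ+\Delta_\prec$, for all $x,y\in A$: (1) $\Delta_{\prec}(x\cdot y)=(R_{\cdot}(y)\otimes I)\Delta_{\prec}(x)-(I\otimes L_{\succ}(x))\Delta_{\prec}(y)$; (2) $\Delta_{\succ}(x\cdot y)=(I\otimes L_{\cdot}(x))\Delta_{\succ}(y)-(R_{\prec}(y)\otimes I)\Delta_{\succ}(x)$; (3) $\Delta(x\prec y)=(R_{\prec}(y)\otimes I)\Delta(x)-(I\otimes L_{\prec}(x))\Delta_{\succ}(y)$; (4) $\Delta(x\succ y)=(I\otimes L_{\succ}(x))\Delta(y)-(R_{\succ}(y)\otimes I)\Delta_{\prec}(x)$; (5) $(L_{\succ}(x)\otimes I)\Delta(y)+(R_{\succ}(y)\otimes I)\tau\Delta_{\succ}(x)-(I\otimes L_{\prec}(y))\tau\Delta_{\prec}(x)-(I\otimes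 R_{\prec}(x))\Delta(y)=0$; (6) $(I\otimes R_{\cdot}(y))\Delta_{\succ}(x)+(L_{\succ}(y)\otimes I)\Delta_{\succ}(x)-\tau(I\otimes R_{\prec}(x))\Delta_{\prec}(y)-\tau(L_{\cdot}(x)\otimes I)\Delta_{\prec}(y)=0$. Such a bialgebra of the form $(A,\succ,\prec,\Delta_{\succ,r},\Delta_{\prec,r})$ is quasi-triangular if $r$ solves the AD-YBE and $r+\tau(r)$ is invariant. An $A$-anti-dendriform algebra $(V,\succ_V,\prec_V,l_\succ,r_\succ,l_\prec,r_\prec)$ consists of operations on $V$ and linear maps $A\to\mathrm{End}(V)$ such that $A\oplus V$ with $(x+a)\succeq(y+b)=x\succ y+l_\succ(x)b+r_\succ(y)a+a\succ_V b$ and $(x+a)\preceq(y+b)=x\prec y+l_\prec(x)b+r_\prec(y)a+a\prec_V b$ is an anti-dendriform algebra. An $A$-associative algebra $(V,\circ,l_A,r_A)$ is the analogous notion for the associative algebra $(A,\cdot)$ (i.e. $A\oplus V$ with $(x+a)(y+b)=x\cdot y+l_A(x)b+r_A(y)a+a\circ b$ is associative). A relative Rota-Baxter operator of weight $\lambda$ associated with an $A$-anti-dendriform algebra $V$ is a linear map $T:V\to A$ with $T(u)\succ T(v)=T(l_{\succ}(T(u))v+r_{\succ}(T(v))u+\lambda u\succ_V v)$ and $T(u)\prec T(v)=T(l_{\prec}(T(u))v+r_{\prec}(T(v))u+\lambda u\prec_V v)$; for an $A$-associative algebra, $T(u)\cdot T(v)=T(l_A(T(u))v+r_A(T(v))u+\lambda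 u\circ v)$. *)

(* Defs.v *)
From HB Require Import structures.
From mathcomp Require Import all_boot all_algebra.

Set Implicit Arguments.
Unset Strict Implicit.
Unset Printing Implicit Defensive.

Import GRing.Theory.
Local Open Scope ring_scope.

Definition bilinear_map (k : fieldType) (U V W : vectType k)
    (f : U -> V -> W) : Prop :=
  (forall v, linear (f^~ v)) /\ (forall u, linear (f u)).

(* V (x) W in coordinates: the matrix t stands for the sum of the             *)
(* t i j *: (e_i (x) e'_j), where e and e' are the bases vbasis {:V} and      *)
(* vbasis {:W}.  The lemmas tpure_bilinear, tlift_linear, tlift_pure and      *)
(* tens_decomp below say that this is the tensor product of V and W, tlift    *)
(* being the extension of a bilinear map to a linear one.                     *)
Notation tens V W := 'M_(\dim (fullv : {vspace V}), \dim (fullv : {vspace W})).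

Definition tpure (k : fieldType) (V W : vectType k) (v : V) (w : W) :
    'M[k]_(\dim {:V}, \dim {:W}) :=
  \matrix_(i, j) (coord (vbasis {:V}) i v * coord (vbasis {:W}) j w).

Notation "v ⊗ w" := (tpure v w) (at level 40, left associativity) : ring_scope.

Definition tlift (k : fieldType) (V W U : vectType k) (f : V -> W -> U)
    (t : tens V W) : U :=
  \sum_i \sum_j t i j *: f (vbasis {:V})`_i (vbasis {:W})`_j.

Section TensorTheory.
Variables (k : fieldType) (V W U : vectType k).

Lemma tpure_bilinear : bilinear_map (@tpure k V W).
Proof.
split=> u c v w; apply/matrixP=> i j; rewrite !mxE linearP /=.
  by rewrite mulrDl mulrA.
by rewrite mulrDr mulrCA.
Qed.

Lemma tlift_linear (f : V -> W -> U) : linear (tlift f).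
Proof.
move=> c s t; rewrite /tlift scaler_sumr -big_split; apply: eq_bigr => i _ /=.
rewrite scaler_sumr -big_split; apply: eq_bigr => j _ /=.
by rewrite !mxE scalerDl scalerA.
Qed.

Lemma linear_sum_coord (T T' : vectType k) (g : T -> T') (v : T) :
  linear g ->
  g v = \sum_i coord (vbasis {:T}) i v *: g (vbasis {:T})`_i.
Proof.
move=> lg; pose G := HB.pack_for {linear T -> T'} g
  (GRing.isLinear.Build _ _ _ _ g lg).
rewrite -[LHS]/(G v) {1}(coord_vbasis (memvf v)) linear_sum.
by apply: eq_bigr => i _; rewrite linearZ_LR.
Qed.

Lemma tlift_pure (f : V -> W -> U) v w :
  bilinear_map f -> tlift f (v ⊗ w) = f v w.
Proof.
move=> [fl fr]; rewrite (linear_sum_coord v (fl w)); apply: eq_bigr => i _.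
rewrite (linear_sum_coord w (fr _)) scaler_sumr; apply: eq_bigr => j _.
by rewrite mxE scalerA.
Qed.

Lemma tens_decomp (t : tens V W) :
  exists (n : nat) (a : 'I_n -> V) (b : 'I_n -> W), t = \sum_i a i ⊗ b i.
Proof.
exists (\dim {:V}), (fun i => (vbasis {:V})`_i),
  (fun i => \sum_j t i j *: (vbasis {:W})`_j).
have fV := basis_free (vbasisP {:V}); have fW := basis_free (vbasisP {:W}).
apply/matrixP=> i j; rewrite summxE (bigD1 i) //= [X in _ + X]big1 => [|l nli].
  rewrite addr0 mxE coord_free // eqxx mul1r linear_sum (bigD1 j) //=.
  rewrite linearZ /= coord_free // eqxx mulr1 big1 ?addr0 // => m nmj.
  by rewrite linearZ /= coord_free // (negPf nmj) mulr0.
by rewrite mxE coord_free // (negPf nli) mul0r.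
Qed.

End TensorTheory.

Definition tmap (k : fieldType) (V V' W W' : vectType k) (f : V -> V')
    (g : W -> W') : tens V W -> tens V' W' :=
  tlift (fun v w => f v ⊗ g w).

Definition tflip (k : fieldType) (V W : vectType k) : tens V W -> tens W V :=
  tlift (fun v w => w ⊗ v).

Notation dual V := 'Hom(V, _^o) (only parsing).

Definition tpair (k : fieldType) (V W : vectType k) (zeta : dual V)
    (eta : dual W) : tens V W -> k^o :=
  tlift (fun v w => zeta v * eta w : k^o).

Definition Tmap (k : fieldType) (A : vectType k) (r : tens A A)
    (zeta : dual A) : A :=
  tlift (fun a b => zeta a *: b) r.

Lemma Tmap_pairing (k : fieldType) (A : vectType k) (r : tens A A)
  (zeta eta : dual A) : eta (Tmap r zeta) = tpair zeta eta r.
Proof.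
rewrite /Tmap /tpair /tlift linear_sum; apply: eq_bigr => i _.
rewrite linear_sum; apply: eq_bigr => j _; rewrite linearZ; congr (_ *: _).
exact: linearZ.
Qed.

(* linfun is only meaningful on linear functions, which fun v => u (f x v)    *)
(* and fun x => tpair zeta eta (D x) below are as soon as f x and D are.      *)
Definition dual_act (k : fieldType) (A V : vectType k) (f : A -> V -> V)
    (x : A) (u : dual V) : dual V :=
  linfun (fun v => u (f x v) : k^o).

Lemma dual_actE (k : fieldType) (A V : vectType k) (f : A -> V -> V) (x : A)
  (u : dual V) (v : V) : linear (f x) -> dual_act f x u v = u (f x v).
Proof.
move=> lf; have lg : linear (fun v => u (f x v) : k^o).
  by move=> c v1 v2; rewrite lf linearP.
pose G := HB.pack_for {linear V -> k^o} (fun v => u (f x v) : k^o)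
  (GRing.isLinear.Build _ _ _ _ (fun v => u (f x v) : k^o) lg).
exact: (lfunE G v).
Qed.

Definition dual_op (k : fieldType) (A : vectType k) (D : A -> tens A A)
    (zeta eta : dual A) : dual A :=
  linfun (fun x => tpair zeta eta (D x)).

Lemma dual_opE (k : fieldType) (A : vectType k) (D : A -> tens A A)
  (zeta eta : dual A) (x : A) :
  linear D -> dual_op D zeta eta x = tpair zeta eta (D x).
Proof.
move=> lD; have lg : linear (fun x => tpair zeta eta (D x)).
  by move=> c v1 v2; rewrite lD /tpair tlift_linear.
pose G := HB.pack_for {linear A -> k^o} (fun x => tpair zeta eta (D x))
  (GRing.isLinear.Build _ _ _ _ (fun x => tpair zeta eta (D x)) lg).
exact: (lfunE G x).
Qed.

Definition lmul (A : Type) (op : A -> A -> A) (x y : A) : A := op x y.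
Definition rmul (A : Type) (op : A -> A -> A) (x y : A) : A := op y x.

Definition addop (k : fieldType) (A : vectType k) (suc pre : A -> A -> A)
    (x y : A) : A :=
  suc x y + pre x y.

Definition anti_dendriform (k : fieldType) (A : vectType k)
    (suc pre : A -> A -> A) : Prop :=
  [/\ bilinear_map suc,
      bilinear_map pre &
      forall x y z : A,
        [/\ suc x (suc y z) = - suc (addop suc pre x y) z,
            - suc (addop suc pre x y) z = - pre x (addop suc pre y z),
            - pre x (addop suc pre y z) = pre (pre x y) z &
            pre (suc x y) z = suc x (pre y z)]].

Definition assoc_algebra (k : fieldType) (A : vectType k)
    (dot : A -> A -> A) : Prop :=
  bilinear_map dot /\ (forall x y z : A, dot (dot x y) z = dot x (dot y z)).

Definition ad_invariant (k : fieldType) (A : vectType k)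
    (suc pre : A -> A -> A) (s : tens A A) : Prop :=
  let dot := addop suc pre in
  forall x : A,
    tmap (rmul pre x) id s + tmap id (lmul dot x) s = 0 /\
    tmap (rmul dot x) id s + tmap id (lmul suc x) s = 0.

(* Every r has a decomposition by tens_decomp, and the left-hand side does    *)
(* not depend on it.                                                          *)
Definition AD_YBE (k : fieldType) (A : vectType k) (suc pre : A -> A -> A)
    (r : tens A A) : Prop :=
  let dot := addop suc pre in
  forall (n : nat) (a b : 'I_n -> A), r = \sum_i a i ⊗ b i ->
    \sum_i \sum_j (dot (a i) (a j) ⊗ (b i ⊗ b j)
                   + a j ⊗ (suc (a i) (b j) ⊗ b i)
                   - a i ⊗ (a j ⊗ pre (b i) (b j))) = 0.

Definition AD_bialgebra (k : fieldType) (A : vectType k)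
    (suc pre : A -> A -> A) (Dsuc Dpre : A -> tens A A) : Prop :=
  let dot := addop suc pre in
  let D x := Dsuc x + Dpre x in
  [/\ anti_dendriform suc pre,
      linear Dsuc,
      linear Dpre,
      anti_dendriform (dual_op Dsuc) (dual_op Dpre) &
      forall x y : A,
        [/\ Dpre (dot x y) = tmap (rmul dot y) id (Dpre x)
                             - tmap id (lmul suc x) (Dpre y),
            Dsuc (dot x y) = tmap id (lmul dot x) (Dsuc y)
                             - tmap (rmul pre y) id (Dsuc x),
            D (pre x y) = tmap (rmul pre y) id (D x)
                          - tmap id (lmul pre x) (Dsuc y),
            D (suc x y) = tmap id (lmul suc x) (D y)
                          - tmap (rmul suc y) id (Dpre x) &
            tmap (lmul suc x) id (D y)
              + tmap (rmul suc y) id (tflip (Dsuc x))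
              - tmap id (lmul pre y) (tflip (Dpre x))
              - tmap id (rmul pre x) (D y) = 0 /\
            tmap id (rmul dot y) (Dsuc x)
              + tmap (lmul suc y) id (Dsuc x)
              - tflip (tmap id (rmul pre x) (Dpre y))
              - tflip (tmap (lmul dot x) id (Dpre y)) = 0]].

Definition Dsuc_r (k : fieldType) (A : vectType k) (suc pre : A -> A -> A)
    (r : tens A A) (x : A) : tens A A :=
  - (tmap (rmul pre x) id r + tmap id (lmul (addop suc pre) x) r).

Definition Dpre_r (k : fieldType) (A : vectType k) (suc pre : A -> A -> A)
    (r : tens A A) (x : A) : tens A A :=
  tmap (rmul (addop suc pre) x) id r + tmap id (lmul suc x) r.

Definition quasi_triangular (k : fieldType) (A : vectType k)
    (suc pre : A -> A -> A) (r : tens A A) : Prop :=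
  [/\ AD_bialgebra suc pre (Dsuc_r suc pre r) (Dpre_r suc pre r),
      AD_YBE suc pre r &
      ad_invariant suc pre (r + tflip r)].

Definition sum_op (k : fieldType) (A V : vectType k) (op : A -> A -> A)
    (opV : V -> V -> V) (l r : A -> V -> V) (p q : A * V) : A * V :=
  (op p.1 q.1, l p.1 q.2 + r q.1 p.2 + opV p.2 q.2).

Definition A_anti_dendriform (k : fieldType) (A V : vectType k)
    (suc pre : A -> A -> A) (sucV preV : V -> V -> V)
    (lsuc rsuc lpre rpre : A -> V -> V) : Prop :=
  [/\ bilinear_map sucV /\ bilinear_map preV,
      bilinear_map lsuc /\ bilinear_map rsuc,
      bilinear_map lpre /\ bilinear_map rpre &
      anti_dendriform (sum_op suc sucV lsuc rsuc) (sum_op pre preV lpre rpre)].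

Definition A_assoc_algebra (k : fieldType) (A V : vectType k)
    (dot : A -> A -> A) (dotV : V -> V -> V) (lA rA : A -> V -> V) : Prop :=
  [/\ bilinear_map dotV,
      bilinear_map lA,
      bilinear_map rA &
      assoc_algebra (sum_op dot dotV lA rA)].

Definition rRB_anti_dendriform (k : fieldType) (A V : vectType k)
    (suc pre : A -> A -> A) (sucV preV : V -> V -> V)
    (lsuc rsuc lpre rpre : A -> V -> V) (lambda : k) (T : V -> A) : Prop :=
  linear T /\
  forall u v : V,
    suc (T u) (T v) = T (lsuc (T u) v + rsuc (T v) u + lambda *: sucV u v) /\
    pre (T u) (T v) = T (lpre (T u) v + rpre (T v) u + lambda *: preV u v).

Definition rRB_assoc (k : fieldType) (A V : vectType k)
    (dot : A -> A -> A) (dotV : V -> V -> V) (lA rA : A -> V -> V)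
    (lambda : k) (T : V -> A) : Prop :=
  linear T /\
  forall u v : V,
    dot (T u) (T v) = T (lA (T u) v + rA (T v) u + lambda *: dotV u v).

Definition suc_s (k : fieldType) (A : vectType k) (pre : A -> A -> A)
    (s : tens A A) (zeta eta : dual A) : dual A :=
  dual_act (lmul pre) (Tmap s eta) zeta.

Definition pre_s (k : fieldType) (A : vectType k) (suc pre : A -> A -> A)
    (s : tens A A) (zeta eta : dual A) : dual A :=
  - dual_act (lmul (addop suc pre)) (Tmap s eta) zeta.

Definition dot_s (k : fieldType) (A : vectType k) (suc : A -> A -> A)
    (s : tens A A) (zeta eta : dual A) : dual A :=
  - dual_act (lmul suc) (Tmap s eta) zeta.

(* Main.v *)
From HB Require Import structures.
Require Import Defs.
From mathcomp Require Import all_boot all_algebra ring.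
Import GRing.Theory.
Local Open Scope ring_scope.

(** Write T for T_r, T' for T_{tau r}, S = T + T' and x > y, x < y, x . y for
the operations.  Invariance of s makes x + u |-> x + S u a homomorphism
from A (+) A^* to A, and the A^*-component of every operation on
A (+) A^* factors through it; this makes A (+) A^* anti-dendriform.
Paired with z (x) e (x) t the AD-YBE reads
  z (T' e . T' t) + e (T' t > T z) - t (T z < T e) = 0.
Isolating the last term gives the Rota-Baxter identity for <.  The identity for
the product, paired with z, becomes the same equation after T' z = S z - T z and
invariance, and the identity for > is the difference of the two.  The operations dual to
Delta_r are those induced by T, and z |-> (T z, - z) embeds them in A (+) A^*,
hence they are anti-dendriform.  The compatibility conditions (1)-(4) hold for
every r, and the left-hand sides of (5) and (6) depend on r only through s,
where invariance makes them vanish. *)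

Set Implicit Arguments.
Unset Strict Implicit.
Unset Printing Implicit Defensive.

(** * Linear and bilinear maps given as bare functions *)

Section Linear.
Variables (k : fieldType) (U V : vectType k) (f : U -> V) (hf : linear f).

Let F := HB.pack_for {linear U -> V} f (GRing.isLinear.Build _ _ _ _ f hf).

Lemma lin0 : f 0 = 0. Proof. exact: (linear0 F). Qed.
Lemma linN u : f (- u) = - f u. Proof. exact: (linearN F). Qed.
Lemma linD u v : f (u + v) = f u + f v. Proof. exact: (linearD F). Qed.
Lemma linB u v : f (u - v) = f u - f v. Proof. exact: (linearB F). Qed.
Lemma linZ c u : f (c *: u) = c *: f u. Proof. exact: (linearZ_LR F). Qed.
Lemma lin_sum n (u : 'I_n -> U) : f (\sum_i u i) = \sum_i f (u i).
Proof. exact: (linear_sum F). Qed.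

Lemma linfun_val u : linfun f u = f u. Proof. exact: (lfunE F). Qed.
End Linear.

Section Bilinear.
Variables (k : fieldType) (U V W : vectType k).
Variables (f : U -> V -> W) (hf : bilinear_map f).

Lemma bil_linl v : linear (f^~ v). Proof. by case: hf. Qed.
Lemma bil_linr u : linear (f u). Proof. by case: hf. Qed.
Lemma bilDl u u' v : f (u + u') v = f u v + f u' v.
Proof. exact: (linD (bil_linl v)). Qed.
Lemma bilNl u v : f (- u) v = - f u v.
Proof. exact: (linN (bil_linl v)). Qed.
Lemma bilZl c u v : f (c *: u) v = c *: f u v.
Proof. exact: (linZ (bil_linl v)). Qed.
Lemma bilDr u v v' : f u (v + v') = f u v + f u v'.
Proof. exact: (linD (bil_linr u)). Qed.
Lemma bilNr u v : f u (- v) = - f u v.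
Proof. exact: (linN (bil_linr u)). Qed.
Lemma bilZr c u v : f u (c *: v) = c *: f u v.
Proof. exact: (linZ (bil_linr u)). Qed.
Lemma bil_suml n (u : 'I_n -> U) v : f (\sum_i u i) v = \sum_i f (u i) v.
Proof. exact: (lin_sum (bil_linl v)). Qed.
Lemma bil_sumr n u (v : 'I_n -> V) : f u (\sum_i v i) = \sum_i f u (v i).
Proof. exact: (lin_sum (bil_linr u)). Qed.
End Bilinear.

(* The generic linearN and linearD leave 'Hom(V, W) coerced to a function
   through its {linear V -> W} instance, which blocks later rewriting. *)
Section Hom.
Variables (k : fieldType) (V W : vectType k).
Implicit Types (u v : 'Hom(V, W)) (x y : V).

Lemma homN u x : u (- x) = - u x. Proof. exact: linearN. Qed.
Lemma homD u x y : u (x + y) = u x + u y. Proof. exact: linearD. Qed.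
Lemma homZ u c x : u (c *: x) = c *: u x. Proof. exact: linearZ. Qed.
Lemma hom_sum u n (x : 'I_n -> V) : u (\sum_i x i) = \sum_i u (x i).
Proof. exact: linear_sum. Qed.
Lemma add_homE u v x : (u + v) x = u x + v x. Proof. exact: add_lfunE. Qed.
Lemma opp_homE u x : (- u) x = - u x. Proof. exact: opp_lfunE. Qed.
End Hom.

Lemma hom_bil_sum (k : fieldType) (U V W : vectType k) (f : U -> V -> W)
    (u : 'Hom(W, k^o)) n (c d : 'I_n -> k) (x : 'I_n -> U) (y : 'I_n -> V) :
  bilinear_map f ->
  u (f (\sum_i c i *: x i) (\sum_j d j *: y j)) =
  \sum_i \sum_j c i * d j * u (f (x i) (y j)).
Proof.
move=> bf; rewrite (bil_suml bf) hom_sum; apply: eq_bigr => i _.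
rewrite (bilZl bf) (bil_sumr bf) homZ hom_sum scaler_sumr.
by apply: eq_bigr => j _; rewrite (bilZr bf) homZ -mulrA.
Qed.

(** * Tensors: contractions, functoriality and the flip *)

Section Tensors.
Variable k : fieldType.
Implicit Types V W U : vectType k.

(** The coordinates in [vbasis] are themselves functionals. *)
Lemma dual_sep V (v w : V) : (forall u : 'Hom(V, k^o), u v = u w) -> v = w.
Proof.
move=> e; rewrite (coord_vbasis (memvf v)) (coord_vbasis (memvf w)).
apply: eq_bigr => i _; congr (_ *: _).
have lc : linear (coord (vbasis {:V}) i : V -> k^o).
  by move=> c x y; rewrite linearP.
by have := e (linfun (coord (vbasis {:V}) i : V -> k^o)); rewrite !linfun_val.
Qed.

Lemma tlift_sum_pure V W U (f : V -> W -> U) n a b :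
  bilinear_map f ->
  tlift f (\sum_(i < n) a i ⊗ b i) = \sum_i f (a i) (b i).
Proof.
move=> bf; rewrite (lin_sum (tlift_linear f)).
by apply: eq_bigr => i _; rewrite tlift_pure.
Qed.

(** Serves for the linearity of Delta_r, where x parametrizes the operators applied to r. *)
Lemma tlift_linear_param V W U U' (F : U' -> V -> W -> U) (t : tens V W) :
  (forall v w, linear (fun x => F x v w)) -> linear (fun x => tlift (F x) t).
Proof.
move=> lF c x y; rewrite /tlift scaler_sumr -big_split; apply: eq_bigr => i _.
rewrite /= scaler_sumr -big_split; apply: eq_bigr => j _ /=.
by rewrite lF scalerDr !scalerA mulrC.
Qed.

Lemma slice_bilinear V W (zeta : 'Hom(V, k^o)) :
  bilinear_map (fun v (w : W) => zeta v *: w).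
Proof.
split=> [w c v v'|v c w w'] /=; first by rewrite linearP scalerDl scalerA.
by rewrite scalerDr !scalerA mulrC.
Qed.

(** [Tmap] is the case V = W = A. With W arbitrary, slices can be iterated on the triple tensors of
    the AD-YBE. *)
Definition slice V W (zeta : 'Hom(V, k^o)) : tens V W -> W :=
  tlift (fun v w => zeta v *: w).

(** Slicing by the i-th coordinate functional and taking the j-th coordinate recovers the entry (i,
    j). *)
Lemma slice_inj V W (t t' : tens V W) :
  (forall zeta, slice zeta t = slice zeta t') -> t = t'.
Proof.
have [n [a [b ->]]] := tens_decomp t.
have [m [c [d ->]]] := tens_decomp t'.
move=> e; apply/matrixP => i j; rewrite !summxE.
have lc : linear (coord (vbasis {:V}) i : V -> k^o).
  by move=> x y z; rewrite linearP.
have := e (linfun (coord (vbasis {:V}) i : V -> k^o)).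
rewrite /slice !tlift_sum_pure; [|exact: slice_bilinear..].
move/(congr1 (coord (vbasis {:W}) j)); rewrite !linear_sum => e'.
under eq_bigr do rewrite mxE; under [RHS]eq_bigr do rewrite mxE.
under eq_bigr do rewrite -(linfun_val lc) -linearZ.
by under [RHS]eq_bigr do rewrite -(linfun_val lc) -linearZ.
Qed.

Lemma tmap_bilinear V V' W W' (f : V -> V') (g : W -> W') :
  linear f -> linear g -> bilinear_map (fun v w => f v ⊗ g w).
Proof.
move=> lf lg; have bp := @tpure_bilinear k V' W'.
split=> [w c v v'|v c w w'] /=.
  by rewrite lf (bilDl bp) (bilZl bp).
by rewrite lg (bilDr bp) (bilZr bp).
Qed.

Lemma tmap_pure V V' W W' (f : V -> V') (g : W -> W') v w :
  linear f -> linear g -> tmap f g (v ⊗ w) = f v ⊗ g w.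
Proof. by move=> lf lg; rewrite /tmap tlift_pure //; apply: tmap_bilinear. Qed.

Lemma eq_tmap V V' W W' (f f' : V -> V') (g g' : W -> W') (t : tens V W) :
  f =1 f' -> g =1 g' -> tmap f g t = tmap f' g' t.
Proof.
move=> ef eg; rewrite /tmap /tlift; apply: eq_bigr => i _.
by apply: eq_bigr => j _; rewrite ef eg.
Qed.

Lemma tmap_comp V V' V'' W W' W'' (f : V' -> V'') (f' : V -> V')
    (g : W' -> W'') (g' : W -> W') (t : tens V W) :
  linear f -> linear g ->
  tmap f g (tmap f' g' t) = tmap (f \o f') (g \o g') t.
Proof.
move=> lf lg; have lt : linear (tmap f g) := tlift_linear _.
rewrite [tmap f' g' t]/tmap /tlift (lin_sum lt); apply: eq_bigr => i _.
rewrite (lin_sum lt); apply: eq_bigr => j _.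
by rewrite (linZ lt) tmap_pure.
Qed.

Lemma tflip_bilinear V W : bilinear_map (fun (v : V) (w : W) => w ⊗ v).
Proof.
have [bl br] := @tpure_bilinear k W V.
by split=> [w|v]; [apply: br | apply: bl].
Qed.

Lemma tflip_tmap V V' W W' (f : V -> V') (g : W -> W') (t : tens V W) :
  linear f -> linear g -> tflip (tmap f g t) = tmap g f (tflip t).
Proof.
move=> lf lg; have [n [a [b ->]]] := tens_decomp t.
rewrite /tmap /tflip !tlift_sum_pure //.
all: by [apply: tflip_bilinear | apply: tmap_bilinear].
Qed.

Lemma tflipK V W (t : tens V W) : tflip (tflip t) = t.
Proof.
have [n [a [b ->]]] := tens_decomp t.
rewrite /tflip tlift_sum_pure; last exact: tflip_bilinear.
by rewrite tlift_sum_pure //; apply: tflip_bilinear.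
Qed.

Lemma tmap_linear V V' W W' (f : V -> V') (g : W -> W') : linear (tmap f g).
Proof. exact: tlift_linear. Qed.

Lemma tflip_linear V W : linear (@tflip k V W).
Proof. exact: tlift_linear. Qed.

Lemma tmapDl V V' W W' (f f' : V -> V') (g : W -> W') (t : tens V W) :
  tmap (fun v => f v + f' v) g t = tmap f g t + tmap f' g t.
Proof.
have bp := @tpure_bilinear k V' W'.
rewrite /tmap /tlift -big_split; apply: eq_bigr => i _.
rewrite -big_split; apply: eq_bigr => j _ /=.
by rewrite (bilDl bp) scalerDr.
Qed.

Lemma tmapDr V V' W W' (f : V -> V') (g g' : W -> W') (t : tens V W) :
  tmap f (fun w => g w + g' w) t = tmap f g t + tmap f g' t.
Proof.
have bp := @tpure_bilinear k V' W'.
rewrite /tmap /tlift -big_split; apply: eq_bigr => i _.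
rewrite -big_split; apply: eq_bigr => j _ /=.
by rewrite (bilDr bp) scalerDr.
Qed.

Lemma tmapNl V V' W W' (f : V -> V') (g : W -> W') (t : tens V W) :
  tmap (fun v => - f v) g t = - tmap f g t.
Proof.
have bp := @tpure_bilinear k V' W'.
rewrite /tmap /tlift -sumrN; apply: eq_bigr => i _.
rewrite -sumrN; apply: eq_bigr => j _ /=.
by rewrite (bilNl bp) scalerN.
Qed.

Lemma tmapNr V V' W W' (f : V -> V') (g : W -> W') (t : tens V W) :
  tmap f (fun w => - g w) t = - tmap f g t.
Proof.
have bp := @tpure_bilinear k V' W'.
rewrite /tmap /tlift -sumrN; apply: eq_bigr => i _.
rewrite -sumrN; apply: eq_bigr => j _ /=.
by rewrite (bilNr bp) scalerN.
Qed.

End Tensors.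

Lemma lmul_linear (k : fieldType) (A : vectType k) (op : A -> A -> A) x :
  bilinear_map op -> linear (lmul op x).
Proof. by move=> bo; apply: (bil_linr bo). Qed.

Lemma rmul_linear (k : fieldType) (A : vectType k) (op : A -> A -> A) x :
  bilinear_map op -> linear (rmul op x).
Proof. by move=> bo; apply: (bil_linl bo). Qed.

(** * Normal forms for operators on the tensor square of A *)

Section TensorSquare.
Variables (k : fieldType) (A : vectType k).
Implicit Types (f g : A -> A) (t u : 'M[k]_(\dim {:A}, \dim {:A})).

Lemma tmapN f g t : tmap f g (- t) = - tmap f g t.
Proof. exact: (linN (@tmap_linear k A A A A f g)). Qed.

Lemma tmapD f g t u : tmap f g (t + u) = tmap f g t + tmap f g u.
Proof. exact: (linD (@tmap_linear k A A A A f g)). Qed.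

Lemma tflipN t : tflip (- t) = - tflip t.
Proof. exact: (linN (@tflip_linear k A A)). Qed.

Lemma tflipD t u : tflip (t + u) = tflip t + tflip u.
Proof. exact: (linD (@tflip_linear k A A)). Qed.

Lemma eq_tmapl f g t : f =1 g -> tmap f id t = tmap g id t.
Proof. by move=> e; apply: eq_tmap. Qed.

Lemma eq_tmapr f g t : f =1 g -> tmap id f t = tmap id g t.
Proof. by move=> e; apply: eq_tmap. Qed.

Lemma eq_tmapNl f g t :
  f =1 (fun a => - g a) -> tmap f id t = - tmap g id t.
Proof. by move=> e; rewrite -tmapNl; apply: eq_tmap. Qed.

Lemma eq_tmapNr f g t :
  f =1 (fun a => - g a) -> tmap id f t = - tmap id g t.
Proof. by move=> e; rewrite -tmapNr; apply: eq_tmap. Qed.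

(** This rule and the next three merge successive one-sided operators, so that expressions become
    sums of terms [tmap f g t] comparable as atoms. *)
Lemma tmap_ll f g t :
  linear f -> tmap f id (tmap g id t) = tmap (f \o g) id t.
Proof. by move=> lf; rewrite tmap_comp. Qed.

Lemma tmap_rr f g t :
  linear f -> tmap id f (tmap id g t) = tmap id (f \o g) t.
Proof. by move=> lf; rewrite tmap_comp. Qed.

Lemma tmap_lr f g t : linear f -> tmap f id (tmap id g t) = tmap f g t.
Proof. by move=> lf; rewrite tmap_comp. Qed.

Lemma tmap_rl f g t : linear f -> tmap id f (tmap g id t) = tmap g f t.
Proof. by move=> lf; rewrite tmap_comp. Qed.

End TensorSquare.

Arguments eq_tmapl {k A} f g {t}.
Arguments eq_tmapr {k A} f g {t}.
Arguments eq_tmapNl {k A} f g {t}.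
Arguments eq_tmapNr {k A} f g {t}.

(** * The map T_r *)

Section Tmap.
Variables (k : fieldType) (A : vectType k).
Implicit Types (zeta eta : 'Hom(A, k^o)).

Lemma Tmap_sum_pure n (a b : 'I_n -> A) zeta :
  Tmap (\sum_i a i ⊗ b i) zeta = \sum_i zeta (a i) *: b i.
Proof. by rewrite /Tmap tlift_sum_pure //; apply: slice_bilinear. Qed.

Lemma Tmap_linear (r : tens A A) : linear (Tmap r).
Proof.
move=> c z z'; have [n [a [b ->]]] := tens_decomp r.
rewrite !Tmap_sum_pure scaler_sumr -big_split; apply: eq_bigr => i _ /=.
by rewrite !lfunE /= !lfunE /= scalerDl scalerA.
Qed.

Lemma Tmap_linearl zeta : linear (fun r : tens A A => Tmap r zeta).
Proof. exact: tlift_linear. Qed.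

(** T_{tau r} is the transpose of T_r, as the flip exchanges the factors of r that the two
    functionals see. *)
Lemma Tmap_flip (r : tens A A) zeta eta :
  eta (Tmap (tflip r) zeta) = zeta (Tmap r eta).
Proof.
have [n [a [b ->]]] := tens_decomp r.
rewrite /tflip tlift_sum_pure; last exact: tflip_bilinear.
rewrite !Tmap_sum_pure !linear_sum; apply: eq_bigr => i _.
by rewrite !linearZ; apply: mulrC.
Qed.

(** With [Tmap_tmapr], this translates tensor identities into operator identities: an operator on
    the first factor acts by its transpose on the argument of T_r, one on the second factor acts on
    the value. *)
Lemma Tmap_tmapl (f : A -> A -> A) x (r : tens A A) zeta : linear (f x) ->
  Tmap (tmap (f x) id r) zeta = Tmap r (dual_act f x zeta).
Proof.
move=> lf; have [n [a [b ->]]] := tens_decomp r.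
rewrite /tmap tlift_sum_pure; last exact: tmap_bilinear.
by rewrite !Tmap_sum_pure; apply: eq_bigr => i _; rewrite dual_actE.
Qed.

Lemma Tmap_tmapr (f : A -> A) (r : tens A A) zeta : linear f ->
  Tmap (tmap id f r) zeta = f (Tmap r zeta).
Proof.
move=> lf; have [n [a [b ->]]] := tens_decomp r.
rewrite /tmap tlift_sum_pure; last exact: tmap_bilinear.
rewrite !Tmap_sum_pure (lin_sum lf); apply: eq_bigr => i _.
by rewrite (linZ lf).
Qed.

End Tmap.

(** * Anti-dendriform algebras: transport, associativity, bilinearity *)

Lemma anti_dendriform_inj (k : fieldType) (V B : vectType k)
    (sucV preV : V -> V -> V) (sucB preB : B -> B -> B) (phi : V -> B) :
  linear phi -> injective phi ->
  (forall u v, phi (sucV u v) = sucB (phi u) (phi v)) ->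
  (forall u v, phi (preV u v) = preB (phi u) (phi v)) ->
  anti_dendriform sucB preB -> anti_dendriform sucV preV.
Proof.
move=> lphi iphi hs hp [bs bp ad]; split=> [||u v w].
(* Every axiom, bilinearity included, is an equation in V, hence can be checked in B after applying
   the injective [phi]. *)
- split=> [w c u v|u c v w]; apply: iphi; rewrite hs !(lphi, hs).
    by rewrite (bilDl bs) (bilZl bs).
  by rewrite (bilDr bs) (bilZr bs).
- split=> [w c u v|u c v w]; apply: iphi; rewrite hp !(lphi, hp).
    by rewrite (bilDl bp) (bilZl bp).
  by rewrite (bilDr bp) (bilZr bp).
have hd a b : phi (addop sucV preV a b) = addop sucB preB (phi a) (phi b).
  by rewrite /addop (linD lphi) hs hp.
have [e1 e2 e3 e4] := ad (phi u) (phi v) (phi w).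
by split; apply: iphi; rewrite ?(linN lphi) ?(hs, hp, hd) ?(hs, hp, hd).
Qed.

Lemma addop_bilinear (k : fieldType) (A : vectType k) (suc pre : A -> A -> A) :
  bilinear_map suc -> bilinear_map pre -> bilinear_map (addop suc pre).
Proof.
move=> bs bp; split=> [w c u v|u c v w]; rewrite /addop /=.
  by rewrite (bilDl bs) (bilDl bp) (bilZl bs) (bilZl bp) scalerDr addrACA.
by rewrite (bilDr bs) (bilDr bp) (bilZr bs) (bilZr bp) scalerDr addrACA.
Qed.

(** Both bracketings equal x > (y < z). On the left (x . y) > z cancels (x < y) < z and (x > y) < z
    remains; on the right x < (y . z) cancels x > (y > z). *)
Lemma anti_dendriform_assoc (k : fieldType) (A : vectType k)
    (suc pre : A -> A -> A) :
  anti_dendriform suc pre -> assoc_algebra (addop suc pre).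
Proof.
move=> [bs bp ad]; split=> [|x y z]; first exact: addop_bilinear.
have [e1 e2 e3 e4] := ad x y z.
have E a b : addop suc pre a b = suc a b + pre a b by [].
have l : suc (addop suc pre x y) z = - suc x (suc y z) by rewrite e1 opprK.
have r : pre x (addop suc pre y z) = - suc x (suc y z).
  by rewrite e1 e2 opprK.
rewrite (E (addop suc pre x y) z) (E x (addop suc pre y z)) l r.
rewrite (E x y) (E y z) (bilDl bp) (bilDr bs) e4 -e3 -e2 -e1.
by rewrite addrCA addNr addrAC subrr add0r addr0.
Qed.

Lemma dual_act_bilinear (k : fieldType) (A V : vectType k) (f : A -> V -> V) :
  bilinear_map f -> bilinear_map (dual_act f).
Proof.
move=> bf; split=> [u c x x'|x c u u']; apply/lfunP => v.
  rewrite lfunE /= lfunE /= !(dual_actE _ _ (bil_linr bf _)).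
  by rewrite (bilDl bf) (bilZl bf) linearP.
rewrite lfunE /= lfunE /= !(dual_actE _ _ (bil_linr bf _)).
by rewrite lfunE /= lfunE.
Qed.

Lemma rmul_bilinear (k : fieldType) (A : vectType k) (op : A -> A -> A) :
  bilinear_map op -> bilinear_map (rmul op).
Proof. by case. Qed.

Lemma opp_bilinear (k : fieldType) (U V W : vectType k) (f : U -> V -> W) :
  bilinear_map f -> bilinear_map (fun u v => - f u v).
Proof.
move=> bf; split=> [v c u u'|u c v v'] /=.
  by rewrite (bilDl bf) (bilZl bf) opprD scalerN.
by rewrite (bilDr bf) (bilZr bf) opprD scalerN.
Qed.

Lemma add3ACA (V : nmodType) (a b c d e f : V) :
  a + b + (c + d) + (e + f) = a + c + e + (b + d + f).
Proof. by rewrite (addrACA a) (addrACA (a + c)). Qed.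

Lemma sum_op_bilinear (k : fieldType) (A V : vectType k) (op : A -> A -> A)
    (opV : V -> V -> V) (l r : A -> V -> V) :
  bilinear_map op -> bilinear_map opV -> bilinear_map l -> bilinear_map r ->
  bilinear_map (sum_op op opV l r).
Proof.
move=> bo bv bl br; split=> [[z w] c [x u] [y v]|[x u] c [y v] [z w]].
  apply: (@injective_projections A V) => /=.
  by rewrite (bilDl bo) (bilZl bo).
  rewrite (bilDl bl) (bilZl bl) (bilDr br) (bilZr br) (bilDl bv) (bilZl bv).
  by rewrite !scalerDr add3ACA.
apply: (@injective_projections A V) => /=.
  by rewrite (bilDr bo) (bilZr bo).
rewrite (bilDr bl) (bilZr bl) (bilDl br) (bilZl br) (bilDr bv) (bilZr bv).
by rewrite !scalerDr add3ACA.
Qed.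

(** * Dual actions on A^* and triple products *)

Section AntiDendriform.
Variables (k : fieldType) (A : vectType k) (suc pre : A -> A -> A).
Hypothesis hA : anti_dendriform suc pre.

Let dot := addop suc pre.
Let l_suc x (u : 'Hom(A, k^o)) := - dual_act (rmul dot) x u.
Let r_suc x (u : 'Hom(A, k^o)) := dual_act (lmul pre) x u.
Let l_pre x (u : 'Hom(A, k^o)) := dual_act (rmul suc) x u.
Let r_pre x (u : 'Hom(A, k^o)) := - dual_act (lmul dot) x u.
Let l_dot x (u : 'Hom(A, k^o)) := - dual_act (rmul pre) x u.
Let r_dot x (u : 'Hom(A, k^o)) := - dual_act (lmul suc) x u.

Lemma suc_bilinear : bilinear_map suc. Proof. by case: hA. Qed.
Lemma pre_bilinear : bilinear_map pre. Proof. by case: hA. Qed.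
Lemma dot_bilinear : bilinear_map dot.
Proof. exact: addop_bilinear suc_bilinear pre_bilinear. Qed.

Lemma dual_lmulE (op : A -> A -> A) x (u : 'Hom(A, k^o)) w :
  bilinear_map op -> dual_act (lmul op) x u w = u (op x w).
Proof. by move=> bo; rewrite dual_actE //; apply: bil_linr. Qed.

Lemma dual_rmulE (op : A -> A -> A) x (u : 'Hom(A, k^o)) w :
  bilinear_map op -> dual_act (rmul op) x u w = u (op w x).
Proof.
by move=> bo; rewrite dual_actE //; apply: (bil_linr (rmul_bilinear bo)).
Qed.

(** All six composites reduce to a > (b < c) or, up to sign, to a > (b > c). Packed as a product,
    the equations form a single set of rewrite rules. *)
Lemma tripleE a b c :
  (dot (dot a b) c = suc a (pre b c)) *
  (dot a (dot b c) = suc a (pre b c)) *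
  (pre (suc a b) c = suc a (pre b c)) *
  (suc (dot a b) c = - suc a (suc b c)) *
  (pre a (dot b c) = - suc a (suc b c)) *
  (pre (pre a b) c = suc a (suc b c)).
Proof.
have [_ _ /(_ a b c) [e1 e2 e3 e4]] := hA.
have [_ /(_ a b c) assoc] := anti_dendriform_assoc hA.
have e5 : pre a (dot b c) = - suc a (suc b c) by rewrite e1 e2 opprK.
have e6 : dot a (dot b c) = suc a (pre b c).
  rewrite -[LHS]/(suc a (suc b c + pre b c) + pre a (dot b c)) e5.
  by rewrite (bilDr suc_bilinear) addrAC subrr add0r.
have e7 : dot (dot a b) c = suc a (pre b c) by rewrite -e6 -[RHS]assoc.
have e8 : suc (dot a b) c = - suc a (suc b c) by rewrite e1 opprK.
have e9 : pre (pre a b) c = suc a (suc b c) by rewrite -e3 -e2 -e1.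
by do !split.
Qed.

(** * The algebra A (+) A^* attached to a symmetric invariant s *)

Section Invariant.
Variable s : 'M[k]_(\dim {:A}, \dim {:A}).
Hypotheses (s_inv : ad_invariant suc pre s) (s_sym : tflip s = s).

Let S := Tmap s.
Let S_linear : linear S := @Tmap_linear k A s.

Lemma TmapC (z z' : 'Hom(A, k^o)) : z (S z') = z' (S z).
Proof. by rewrite /S -{1}s_sym Tmap_flip. Qed.

(** The first invariance equation, read through T_s as an identity of maps from A^* to A; [suc_S] is
    the second. *)
Lemma dot_S x z : dot x (S z) = - S (dual_act (rmul pre) x z).
Proof.
have [e _] := s_inv x; apply/eqP; rewrite -addr_eq0 addrC; apply/eqP.
have := congr1 (fun t : tens A A => Tmap t z) e.
rewrite (linD (Tmap_linearl z)) (lin0 (Tmap_linearl z)).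
rewrite Tmap_tmapl ?Tmap_tmapr //; first exact: (bil_linr dot_bilinear).
exact: (bil_linr (rmul_bilinear pre_bilinear)).
Qed.

Lemma suc_S x z : suc x (S z) = - S (dual_act (rmul dot) x z).
Proof.
have [_ e] := s_inv x; apply/eqP; rewrite -addr_eq0 addrC; apply/eqP.
have := congr1 (fun t : tens A A => Tmap t z) e.
rewrite (linD (Tmap_linearl z)) (lin0 (Tmap_linearl z)).
rewrite Tmap_tmapl ?Tmap_tmapr //; first exact: (bil_linr suc_bilinear).
exact: (bil_linr (rmul_bilinear dot_bilinear)).
Qed.

(** The transpose of [dot_S], since S is self-adjoint. In the same way [S_suc] is the transpose of
    [pre_S]. *)
Lemma S_pre x z : pre (S z) x = - S (dual_act (lmul dot) x z).
Proof.
apply: dual_sep => u; rewrite homN -(dual_rmulE _ _ _ pre_bilinear).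
rewrite (TmapC _ z) (TmapC u) (dual_lmulE _ _ _ dot_bilinear) dot_S.
by rewrite homN opprK.
Qed.

(** The difference of [dot_S] and [suc_S]. *)
Lemma pre_S x z : pre x (S z) = S (dual_act (rmul suc) x z).
Proof.
have -> : dual_act (rmul suc) x z
    = dual_act (rmul dot) x z - dual_act (rmul pre) x z.
  apply/lfunP => w; rewrite add_homE opp_homE (dual_rmulE _ _ _ suc_bilinear).
  rewrite (dual_rmulE _ _ _ dot_bilinear) (dual_rmulE _ _ _ pre_bilinear).
  by rewrite -homN -homD /dot /addop addrK.
by rewrite (linB S_linear) -dot_S -[S (dual_act _ _ _)]opprK -suc_S addKr.
Qed.

Lemma S_suc x z : suc (S z) x = S (dual_act (lmul pre) x z).
Proof.
apply: dual_sep => u; rewrite -(dual_rmulE _ _ _ suc_bilinear).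
by rewrite (TmapC _ z) (TmapC u) (dual_lmulE _ _ _ pre_bilinear) pre_S.
Qed.

Let sucD := sum_op suc (suc_s pre s) l_suc r_suc.
Let preD := sum_op pre (pre_s suc pre s) l_pre r_pre.

Definition diag (p : A * 'Hom(A, k^o)) : A := p.1 + S p.2.

(** The terms from [r_suc] and [suc_s] are both L_<^* acting on p.2, at q.1 and at S q.2; together
    they act at [diag q]. The same merging gives [preD_2] and [dotD_2]. *)
Lemma sucD_2 p q w :
  (sucD p q).2 w = - q.2 (dot w p.1) + p.2 (pre (diag q) w).
Proof.
rewrite /= !add_homE opp_homE (dual_rmulE _ _ _ dot_bilinear).
rewrite !(dual_lmulE _ _ _ pre_bilinear) -addrA -homD.
by rewrite -(bilDl pre_bilinear).
Qed.

Lemma preD_2 p q w :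
  (preD p q).2 w = q.2 (suc w p.1) - p.2 (dot (diag q) w).
Proof.
rewrite /= !add_homE !opp_homE (dual_rmulE _ _ _ suc_bilinear).
rewrite !(dual_lmulE _ _ _ dot_bilinear) -addrA -opprD -homD.
by rewrite -(bilDl dot_bilinear).
Qed.

(** Of the four terms of (x + S u) > (y + S v), the three that involve S are values of S by [suc_S]
    and [S_suc], and match the three terms of the A^*-component. *)
Lemma diag_suc p q : diag (sucD p q) = suc (diag p) (diag q).
Proof.
rewrite /diag /= !(linD S_linear) (linN S_linear).
rewrite (bilDl suc_bilinear) !(bilDr suc_bilinear).
by rewrite suc_S S_suc [suc (S _) (S _)]S_suc !addrA.
Qed.

Lemma diag_pre p q : diag (preD p q) = pre (diag p) (diag q).
Proof.
rewrite /diag /= !(linD S_linear) !(linN S_linear).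
rewrite (bilDl pre_bilinear) !(bilDr pre_bilinear).
by rewrite pre_S S_pre [pre (S _) (S _)]S_pre !addrA.
Qed.

Lemma dotD_2 p q w :
  (addop sucD preD p q).2 w = - q.2 (pre w p.1) - p.2 (suc (diag q) w).
Proof. rewrite add_homE sucD_2 preD_2 /dot /addop !homD; ring. Qed.

Lemma Tmap_op_bilinear (f : A -> 'Hom(A, k^o) -> 'Hom(A, k^o)) :
  bilinear_map f -> bilinear_map (fun u v => f (S v) u).
Proof.
move=> bf; split=> [v|u c v v']; first exact: (bil_linr bf).
by rewrite S_linear (bilDl bf) (bilZl bf).
Qed.

Lemma A_anti_dendriform_s :
  A_anti_dendriform suc pre (suc_s pre s) (pre_s suc pre s)
    l_suc r_suc l_pre r_pre.
Proof.
have bs := suc_bilinear; have bp := pre_bilinear; have bd := dot_bilinear.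
have bsD : bilinear_map (suc_s pre s).
  by apply: Tmap_op_bilinear; apply: dual_act_bilinear.
have bpD : bilinear_map (pre_s suc pre s).
  by apply/opp_bilinear/Tmap_op_bilinear/dual_act_bilinear.
have bls : bilinear_map l_suc.
  by apply/opp_bilinear/dual_act_bilinear/rmul_bilinear.
have brs : bilinear_map r_suc by apply: dual_act_bilinear.
have blp : bilinear_map l_pre by apply/dual_act_bilinear/rmul_bilinear.
have brp : bilinear_map r_pre by apply/opp_bilinear/dual_act_bilinear.
split=> //; split=> [||p q r]; [exact: sum_op_bilinear..|].
have diag_dot a b : diag (addop sucD preD a b) = dot (diag a) (diag b).
  rewrite -[RHS]/(suc _ _ + pre _ _) -diag_suc -diag_pre /diag /=.
  by rewrite (linD S_linear) addrACA.
have opp_2 (a : A * 'Hom(A, k^o)) w : (- a).2 w = - a.2 w by exact: opp_homE.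
have [_ _ ad] := hA; have [e1 e2 e3 e4] := ad p.1 q.1 r.1.
have dot1 a b : (addop sucD preD a b).1 = dot a.1 b.1 by [].
(* The A-component is the axiom in A. The A^*-component at w is a combination of values of p.2, q.2
   and r.2 at triple products, which [tripleE] brings to normal form. *)
split; apply: (@injective_projections A _) => //; apply/lfunP => w.
- by rewrite (opp_2 (sucD (addop sucD preD p q) r)) !sucD_2 dotD_2 ?dot1
    ?(diag_dot, diag_suc, diag_pre) !tripleE ?homN; ring.
- rewrite (opp_2 (sucD (addop sucD preD p q) r)).
  by rewrite (opp_2 (preD p (addop sucD preD q r))) sucD_2 preD_2 !dotD_2 ?dot1
    ?(diag_dot, diag_suc, diag_pre) !tripleE ?homN; ring.
- by rewrite (opp_2 (preD p (addop sucD preD q r))) !preD_2 dotD_2 ?dot1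
    ?(diag_dot, diag_suc, diag_pre) !tripleE ?homN; ring.
- by rewrite sucD_2 !preD_2 sucD_2 ?dot1
    ?(diag_dot, diag_suc, diag_pre) !tripleE ?homN; ring.
Qed.

(** The product here is the sum of the two operations [sucD] and [preD], so associativity is
    inherited from the anti-dendriform structure. *)
Lemma A_assoc_algebra_s : A_assoc_algebra dot (dot_s suc s) l_dot r_dot.
Proof.
have bs := suc_bilinear; have bp := pre_bilinear; have bd := dot_bilinear.
have bdD : bilinear_map (dot_s suc s).
  by apply/opp_bilinear/Tmap_op_bilinear/dual_act_bilinear.
have bl : bilinear_map l_dot.
  by apply/opp_bilinear/dual_act_bilinear/rmul_bilinear.
have br : bilinear_map r_dot by apply/opp_bilinear/dual_act_bilinear.
have dotE p q : sum_op dot (dot_s suc s) l_dot r_dot p q = addop sucD preD p q.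
  apply: (@injective_projections A _) => //; apply/lfunP => w.
  rewrite dotD_2 /= !add_homE !opp_homE (dual_rmulE _ _ _ pre_bilinear).
  rewrite !(dual_lmulE _ _ _ suc_bilinear) (bilDl suc_bilinear) homD; ring.
have [_ _ _ /anti_dendriform_assoc [_ assoc]] := A_anti_dendriform_s.
split=> //; split=> [|p q t]; first exact: sum_op_bilinear.
by rewrite !dotE.
Qed.

End Invariant.

(** * The AD-YBE as operator identities *)

Section YangBaxter.
Variable r : 'M[k]_(\dim {:A}, \dim {:A}).

Let T := Tmap r.
Let T' := Tmap (tflip r).

Lemma T_T' (u v : 'Hom(A, k^o)) : u (T v) = v (T' u).
Proof. by rewrite /T' Tmap_flip. Qed.

Lemma AD_YBE_pairing :
  AD_YBE suc pre r <-> forall z e t : 'Hom(A, k^o),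
    z (dot (T' e) (T' t)) + e (suc (T' t) (T z)) - t (pre (T z) (T e)) = 0.
Proof.
have bs := suc_bilinear; have bp := pre_bilinear; have bd := dot_bilinear.
(* For any decomposition of r, contracting the three factors with z, e and t collapses the double
   sum into values of T and T'. *)
have pairing n (a b : 'I_n -> A) (z e t : 'Hom(A, k^o)) :
    r = \sum_i a i ⊗ b i ->
    t (slice e (slice z (\sum_i \sum_j (dot (a i) (a j) ⊗ (b i ⊗ b j)
                   + a j ⊗ (suc (a i) (b j) ⊗ b i)
                   - a i ⊗ (a j ⊗ pre (b i) (b j)))))) =
    z (dot (T' e) (T' t)) + e (suc (T' t) (T z)) - t (pre (T z) (T e)).
  move=> er; have eT u : T u = \sum_i u (a i) *: b i.
    by rewrite /T er Tmap_sum_pure.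
  have eT' u : T' u = \sum_i u (b i) *: a i.
    rewrite /T' er /tflip tlift_sum_pure; last exact: tflip_bilinear.
    by rewrite Tmap_sum_pure.
  have lz V (u : 'Hom(A, k^o)) : linear (@slice k A V u).
    exact: tlift_linear.
  have slE (V : vectType k) (u : 'Hom(A, k^o)) x (y : V) :
      slice u (x ⊗ y) = u x *: y.
    by rewrite /slice tlift_pure //; apply: slice_bilinear.
  rewrite !eT !eT' !hom_bil_sum // -sumrN -!big_split /=.
  rewrite (lin_sum (lz _ z)) (lin_sum (lz _ e)) hom_sum.
  apply: eq_bigr => i _; rewrite (lin_sum (lz _ z)) (lin_sum (lz _ e)) hom_sum.
  rewrite -sumrN -!big_split; apply: eq_bigr => j _ /=.
  have scE (c : k) (x : k^o) : c *: x = c * x by [].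
  rewrite !(linN (lz _ _), linD (lz _ _), linZ (lz _ _), slE).
  rewrite !(homD, homN, homZ, scE) /=; ring.
split=> [ybe z e t|ybe ? n a b er].
  have [n [a [b er]]] := tens_decomp r.
  rewrite -(pairing n a b) // ybe //.
  by rewrite /slice !(lin0 (tlift_linear _)) linear0.
have lz V (u : 'Hom(A, k^o)) : linear (@slice k A V u).
  exact: tlift_linear.
(* Slices in the first two factors and functionals on the third separate triple tensors. *)
apply: slice_inj => z; apply: slice_inj => e; apply: dual_sep => t.
by rewrite pairing // ybe !(lin0 (lz _ _)) linear0.
Qed.

(** These are the arguments of T_r in (b) and (c) once simplified. By [dual_op_suc] and
    [dual_op_pre], the first two are also the operations on A^* dual to Delta_r. *)
Definition desc_suc (z e : 'Hom(A, k^o)) : 'Hom(A, k^o) :=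
  - dual_act (rmul dot) (T z) e - dual_act (lmul pre) (T' e) z.
Definition desc_pre (z e : 'Hom(A, k^o)) : 'Hom(A, k^o) :=
  dual_act (rmul suc) (T z) e + dual_act (lmul dot) (T' e) z.
Definition desc_dot (z e : 'Hom(A, k^o)) : 'Hom(A, k^o) :=
  - dual_act (rmul pre) (T z) e + dual_act (lmul suc) (T' e) z.

Lemma desc_sucE z e w : desc_suc z e w = - e (dot w (T z)) - z (pre (T' e) w).
Proof.
rewrite add_homE !opp_homE (dual_rmulE _ _ _ dot_bilinear).
by rewrite (dual_lmulE _ _ _ pre_bilinear).
Qed.

Lemma desc_preE z e w : desc_pre z e w = e (suc w (T z)) + z (dot (T' e) w).
Proof.
rewrite add_homE (dual_rmulE _ _ _ suc_bilinear).
by rewrite (dual_lmulE _ _ _ dot_bilinear).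
Qed.

Lemma desc_dotE z e w : desc_dot z e w = - e (pre w (T z)) + z (suc (T' e) w).
Proof.
rewrite add_homE opp_homE (dual_rmulE _ _ _ pre_bilinear).
by rewrite (dual_lmulE _ _ _ suc_bilinear).
Qed.

Lemma desc_add z e : desc_suc z e + desc_pre z e = desc_dot z e.
Proof.
apply/lfunP => w; rewrite add_homE desc_sucE desc_preE desc_dotE.
rewrite /dot /addop !homD; ring.
Qed.

(** As T' is the transpose of T, pairing T (desc_pre z e) with t evaluates [desc_pre z e] at T' t,
    which yields the first two terms of the paired AD-YBE. *)
Lemma AD_YBE_pre :
  AD_YBE suc pre r <-> forall z e, pre (T z) (T e) = T (desc_pre z e).
Proof.
rewrite AD_YBE_pairing; split=> [ybe z e|eq_pre z e t].
  apply: dual_sep => t; rewrite T_T' desc_preE.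
  by rewrite [RHS]addrC; apply/esym/eqP; rewrite -subr_eq0 ybe.
by rewrite eq_pre T_T' desc_preE; ring.
Qed.

Hypothesis s_inv : ad_invariant suc pre (r + tflip r).

Let S := Tmap (r + tflip r).

Lemma S_def u : S u = T u + T' u.
Proof. exact: (linD (Tmap_linearl u)). Qed.

Lemma s_sym : tflip (r + tflip r) = r + tflip r.
Proof. by rewrite (linD (@tflip_linear k A A)) tflipK addrC. Qed.

Lemma AD_YBE_dot :
  AD_YBE suc pre r <-> forall z e, dot (T z) (T e) = T (desc_dot z e).
Proof.
have bs := suc_bilinear; have bp := pre_bilinear; have bd := dot_bilinear.
have eqE (z e t : 'Hom(A, k^o)) : z (dot (T e) (T t)) - z (T (desc_dot e t)) =
    z (dot (T' e) (T' t)) + e (suc (T' t) (T z)) - t (pre (T z) (T e)).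
  (* Pairing T (desc_dot e t) with z gives two terms containing T' z. After expanding S = T + T',
     [e1] and [e2] are solved for these terms, so that only T z is left. *)
  have e1 : t (pre (S z) (T e)) = - z (dot (T e) (S t)).
    rewrite (S_pre s_inv s_sym) homN (TmapC s_sym).
    by rewrite (dual_lmulE _ _ _ bd).
  have e2 : e (suc (T' t) (S z)) = - z (dot (S e) (T' t)).
    by rewrite (suc_S s_inv) homN (TmapC s_sym) (dual_rmulE _ _ _ bd).
  move: e1 e2; rewrite (T_T' z) desc_dotE !S_def.
  rewrite (bilDl bp) (bilDr bs) (bilDl bd) (bilDr bd) !homD.
  by move=> /(canRL (addKr _)) -> /(canRL (addKr _)) ->; ring.
rewrite AD_YBE_pairing; split=> [ybe e t|eq_dot z e t].
  by apply: dual_sep => z; apply/eqP; rewrite -subr_eq0 eqE ybe.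
by rewrite -eqE eq_dot subrr.
Qed.

Lemma AD_YBE_suc :
  AD_YBE suc pre r -> forall z e, suc (T z) (T e) = T (desc_suc z e).
Proof.
move=> ybe z e; apply: (addIr (pre (T z) (T e))).
rewrite {2}(AD_YBE_pre.1 ybe) -(linD (@Tmap_linear k A r)) desc_add.
exact: AD_YBE_dot.1.
Qed.

(** The weight -1 term subtracts an action at S e from the same action at T e, and T e - S e = - T'
    e. *)
Lemma rRB_anti_dendriformE :
  rRB_anti_dendriform suc pre (suc_s pre (r + tflip r))
    (pre_s suc pre (r + tflip r)) l_suc r_suc l_pre r_pre (-1) T <->
  forall z e, suc (T z) (T e) = T (desc_suc z e) /\
              pre (T z) (T e) = T (desc_pre z e).
Proof.
have bs := suc_bilinear; have bp := pre_bilinear; have bd := dot_bilinear.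
have es z e : l_suc (T z) e + r_suc (T e) z
    + -1 *: suc_s pre (r + tflip r) z e = desc_suc z e.
  apply/lfunP => w; rewrite desc_sucE scaleN1r !add_homE !opp_homE.
  rewrite (dual_rmulE _ _ _ bd) !(dual_lmulE _ _ _ bp) -/(S e) S_def.
  rewrite (bilDl bp) homD; ring.
have ep z e : l_pre (T z) e + r_pre (T e) z
    + -1 *: pre_s suc pre (r + tflip r) z e = desc_pre z e.
  apply/lfunP => w; rewrite desc_preE scaleN1r !add_homE !opp_homE.
  rewrite (dual_rmulE _ _ _ bs) !(dual_lmulE _ _ _ bd) -/(S e) S_def.
  rewrite (bilDl bd) (homD _ (dot (T e) w) (dot (T' e) w)); ring.
split=> [[_ rb] z e|rb]; first by have := rb z e; rewrite es ep.
by split=> [|z e]; [exact: Tmap_linear | rewrite es ep].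
Qed.

Lemma rRB_assocE :
  rRB_assoc dot (dot_s suc (r + tflip r)) l_dot r_dot (-1) T <->
  forall z e, dot (T z) (T e) = T (desc_dot z e).
Proof.
have bs := suc_bilinear; have bp := pre_bilinear.
have ed z e : l_dot (T z) e + r_dot (T e) z
    + -1 *: dot_s suc (r + tflip r) z e = desc_dot z e.
  apply/lfunP => w; rewrite desc_dotE scaleN1r !add_homE !opp_homE.
  rewrite (dual_rmulE _ _ _ bp) !(dual_lmulE _ _ _ bs) -/(S e) S_def.
  rewrite (bilDl bs) homD; ring.
split=> [[_ rb] z e|rb]; first by rewrite rb ed.
by split=> [|z e]; [exact: Tmap_linear | rewrite ed].
Qed.

(** * The coproducts Delta_r *)

Lemma tmap_rmul_linear op :
  bilinear_map op -> linear (fun x => tmap (rmul op x) id r).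
Proof.
move=> bo; apply: tlift_linear_param => v w c x y.
have bt := @tpure_bilinear k A A.
by rewrite /rmul (bilDr bo) (bilZr bo) (bilDl bt) (bilZl bt).
Qed.

Lemma tmap_lmul_linear op :
  bilinear_map op -> linear (fun x => tmap id (lmul op x) r).
Proof.
move=> bo; apply: tlift_linear_param => v w c x y.
have bt := @tpure_bilinear k A A.
by rewrite /lmul (bilDl bo) (bilZl bo) (bilDr bt) (bilZr bt).
Qed.

Lemma Dpre_linear : linear (Dpre_r suc pre r).
Proof.
move=> c x y; rewrite /Dpre_r (tmap_rmul_linear dot_bilinear).
by rewrite (tmap_lmul_linear suc_bilinear) scalerDr addrACA.
Qed.

Lemma Dsuc_linear : linear (Dsuc_r suc pre r).
Proof.
move=> c x y; rewrite /Dsuc_r (tmap_rmul_linear pre_bilinear).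
rewrite (tmap_lmul_linear dot_bilinear) addrACA opprD.
by rewrite -scalerDr scalerN.
Qed.

Lemma dual_op_suc z e : dual_op (Dsuc_r suc pre r) z e = desc_suc z e.
Proof.
apply/lfunP => w; rewrite dual_opE; last exact: Dsuc_linear.
rewrite desc_sucE -Tmap_pairing /Dsuc_r.
rewrite (linN (Tmap_linearl z)) (linD (Tmap_linearl z)).
rewrite Tmap_tmapl; last exact: (bil_linr (rmul_bilinear pre_bilinear)).
rewrite Tmap_tmapr; last exact: (bil_linr dot_bilinear).
rewrite homN homD -/(T _) T_T' (dual_rmulE _ _ _ pre_bilinear).
by rewrite opprD addrC.
Qed.

Lemma dual_op_pre z e : dual_op (Dpre_r suc pre r) z e = desc_pre z e.
Proof.
apply/lfunP => w; rewrite dual_opE; last exact: Dpre_linear.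
rewrite desc_preE -Tmap_pairing /Dpre_r (linD (Tmap_linearl z)).
rewrite Tmap_tmapl; last exact: (bil_linr (rmul_bilinear dot_bilinear)).
rewrite Tmap_tmapr; last exact: (bil_linr suc_bilinear).
rewrite homD -/(T _) T_T' (dual_rmulE _ _ _ dot_bilinear).
by rewrite addrC.
Qed.

Lemma dual_anti_dendriform :
  AD_YBE suc pre r ->
  anti_dendriform (dual_op (Dsuc_r suc pre r)) (dual_op (Dpre_r suc pre r)).
Proof.
move=> ybe; have bd := dot_bilinear.
(* Because of this value of [diag], products of embedded elements have A^*-components - [desc_suc]
   and - [desc_pre]; their A-components agree by the Rota-Baxter identities. *)
have diagE (z : 'Hom(A, k^o)) : diag (r + tflip r) (T z, - z) = - T' z.
  rewrite /diag /= (linN (@Tmap_linear k A _)) -/(S z) S_def opprD addrA.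
  by rewrite subrr sub0r.
have [_ _ _] := A_anti_dendriform_s s_inv s_sym.
apply: (@anti_dendriform_inj _ _ _ _ _ _ _ (fun z => (T z, - z))).
- move=> c z e; apply: (@injective_projections A _) => /=.
    by rewrite /T Tmap_linear.
  by rewrite opprD scalerN.
- by move=> z e [_ /oppr_inj].
- move=> z e; apply: (@injective_projections A _).
    by rewrite dual_op_suc /= (AD_YBE_suc ybe).
  apply/lfunP => w; rewrite (sucD_2 _ (T z, - z)) diagE opp_homE dual_op_suc.
  rewrite desc_sucE /= !opp_homE (bilNl pre_bilinear) homN; ring.
- move=> z e; apply: (@injective_projections A _).
    by rewrite dual_op_pre /= (AD_YBE_pre.1 ybe).
  apply/lfunP => w; rewrite (preD_2 _ (T z, - z)) diagE opp_homE dual_op_pre.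
  rewrite desc_preE /= !opp_homE (bilNl dot_bilinear) homN; ring.
Qed.

Let D x := Dsuc_r suc pre r x + Dpre_r suc pre r x.

(** R_. - R_< = R_> on the first factor and L_> - L_. = - L_< on the second. *)
Lemma DE x : D x = tmap (rmul suc x) id r - tmap id (lmul pre x) r.
Proof.
have e1 : tmap (rmul dot x) id r =
    tmap (rmul suc x) id r + tmap (rmul pre x) id r.
  exact: tmapDl.
have e2 : tmap id (lmul dot x) r =
    tmap id (lmul suc x) r + tmap id (lmul pre x) r.
  exact: tmapDr.
rewrite /D /Dsuc_r /Dpre_r -/dot e1 e2; apply/matrixP => i j; rewrite !mxE.
ring.
Qed.

Lemma Delta_r_mul x y :
  let Dsuc := Dsuc_r suc pre r in
  let Dpre := Dpre_r suc pre r in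
  [/\ Dpre (dot x y) = tmap (rmul dot y) id (Dpre x)
                       - tmap id (lmul suc x) (Dpre y),
      Dsuc (dot x y) = tmap id (lmul dot x) (Dsuc y)
                       - tmap (rmul pre y) id (Dsuc x),
      D (pre x y) = tmap (rmul pre y) id (D x)
                    - tmap id (lmul pre x) (Dsuc y) &
      D (suc x y) = tmap id (lmul suc x) (D y)
                    - tmap (rmul suc y) id (Dpre x)].
Proof.
move=> Dsuc Dpre.
have bs := suc_bilinear; have bp := pre_bilinear; have bd := dot_bilinear.
(* P and Q mark the two normal forms of [tripleE], L and R the tensor factor acted on. Terms acting
   on both factors cancel without any axiom. *)
pose PL a := suc a (pre x y); pose QL a := suc a (suc x y).
pose PR b := suc x (pre y b); pose QR b := suc x (suc y b).
split.
- rewrite /Dpre /Dpre_r -/dot !tmapD !tmap_ll ?tmap_rr ?tmap_lr ?tmap_rl.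
  all: do ?[exact: lmul_linear | exact: rmul_linear].
  rewrite (eq_tmapl _ PL) => [|a]; last by rewrite /= /rmul ?tripleE.
  rewrite (eq_tmapl (rmul dot y \o rmul dot x) PL) => [|a];
    last by rewrite /= /rmul ?tripleE.
  rewrite (eq_tmapNr (lmul suc (dot _ _)) QR) => [|a];
    last by rewrite /= /lmul ?tripleE.
  rewrite (eq_tmapr (lmul suc x \o lmul suc y) QR) => [|a];
    last by rewrite /= /lmul ?tripleE.
  by apply/matrixP => i j; rewrite !mxE; ring.
- rewrite /Dsuc /Dsuc_r -/dot !tmapN !tmapD !tmap_ll ?tmap_rr ?tmap_lr ?tmap_rl.
  all: do ?[exact: lmul_linear | exact: rmul_linear].
  rewrite (eq_tmapNl (rmul pre (dot _ _)) QL) => [|a];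
    last by rewrite /= /rmul ?tripleE.
  rewrite (eq_tmapl (rmul pre y \o rmul pre x) QL) => [|a];
    last by rewrite /= /rmul ?tripleE.
  rewrite (eq_tmapr (lmul dot (dot _ _)) PR) => [|a];
    last by rewrite /= /lmul ?tripleE.
  rewrite (eq_tmapr (lmul dot x \o lmul dot y) PR) => [|a];
    last by rewrite /= /lmul ?tripleE.
  by apply/matrixP => i j; rewrite !mxE; ring.
- rewrite !DE /Dsuc /Dsuc_r -/dot ?tmapN ?tmapD ?tmapN.
  rewrite !tmap_ll ?tmap_rr ?tmap_lr ?tmap_rl.
  all: do ?[exact: lmul_linear | exact: rmul_linear].
  rewrite (eq_tmapl (rmul suc (pre _ _)) PL) => [|a];
    last by rewrite /= /rmul ?tripleE.
  rewrite (eq_tmapl (rmul pre y \o rmul suc x) PL) => [|a];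
    last by rewrite /= /rmul ?tripleE.
  rewrite (eq_tmapr (lmul pre (pre _ _)) QR) => [|a];
    last by rewrite /= /lmul ?tripleE.
  rewrite (eq_tmapNr (lmul pre x \o lmul dot y) QR) => [|a];
    last by rewrite /= /lmul ?tripleE.
  by apply/matrixP => i j; rewrite !mxE; ring.
- rewrite !DE /Dpre /Dpre_r -/dot ?tmapN ?tmapD ?tmapN.
  rewrite !tmap_ll ?tmap_rr ?tmap_lr ?tmap_rl.
  all: do ?[exact: lmul_linear | exact: rmul_linear].
  rewrite (eq_tmapl (rmul suc (suc _ _)) QL) => [|a];
    last by rewrite /= /rmul ?tripleE.
  rewrite (eq_tmapNl (rmul suc y \o rmul dot x) QL) => [|a];
    last by rewrite /= /rmul ?tripleE.
  rewrite (eq_tmapr (lmul pre (suc _ _)) PR) => [|a];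
    last by rewrite /= /lmul ?tripleE.
  rewrite (eq_tmapr (lmul suc x \o lmul pre y) PR) => [|a];
    last by rewrite /= /lmul ?tripleE.
  by apply/matrixP => i j; rewrite !mxE; ring.
Qed.

(** Write the invariance equations [I1] and [I2] below as left side minus right side. Applying
    L_>(x) on the first factor minus R_<(x) on the second to [I2 y] gives (5). Applying R_.(y) on
    the second factor plus L_>(y) on the first to [I1 x] gives (6) up to sign. *)
Lemma Delta_r_flip x y :
  let Dsuc := Dsuc_r suc pre r in
  let Dpre := Dpre_r suc pre r in
  tmap (lmul suc x) id (D y)
    + tmap (rmul suc y) id (tflip (Dsuc x))
    - tmap id (lmul pre y) (tflip (Dpre x))
    - tmap id (rmul pre x) (D y) = 0 /\
  tmap id (rmul dot y) (Dsuc x)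
    + tmap (lmul suc y) id (Dsuc x)
    - tflip (tmap id (rmul pre x) (Dpre y))
    - tflip (tmap (lmul dot x) id (Dpre y)) = 0.
Proof.
move=> Dsuc Dpre.
have bs := suc_bilinear; have bp := pre_bilinear; have bd := dot_bilinear.
have flip_pre z : tflip (Dpre z)
    = tmap id (rmul dot z) (tflip r) + tmap (lmul suc z) id (tflip r).
  by rewrite tflipD !tflip_tmap;
    do ?[exact: lmul_linear | exact: rmul_linear].
have flip_suc z : tflip (Dsuc z)
    = - (tmap id (rmul pre z) (tflip r) + tmap (lmul dot z) id (tflip r)).
  by rewrite tflipN tflipD !tflip_tmap;
    do ?[exact: lmul_linear | exact: rmul_linear].
have I1 z : tmap (rmul pre z) id (r + tflip r) =
    - tmap id (lmul dot z) (r + tflip r).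
  by have [/eqP + _] := s_inv z; rewrite addr_eq0 => /eqP.
(* The second invariance equation minus the first. *)
have I2 z : tmap (rmul suc z) id (r + tflip r) =
    tmap id (lmul pre z) (r + tflip r).
  have [_ e2] := s_inv z.
  have e3 : tmap (rmul dot z) id (r + tflip r)
      = tmap (rmul suc z) id (r + tflip r) + tmap (rmul pre z) id (r + tflip r).
    exact: tmapDl.
  have e4 : tmap id (lmul dot z) (r + tflip r)
      = tmap id (lmul suc z) (r + tflip r) + tmap id (lmul pre z) (r + tflip r).
    exact: tmapDr.
  move/eqP: e2; rewrite -/dot e3 I1 e4 [X in - X]addrC opprD addrA addrNK.
  by rewrite subr_eq0 => /eqP.
split.
  have k1 := congr1 (tmap (lmul suc x) id) (I2 y).
  have k2 := congr1 (tmap id (rmul pre x)) (I2 y).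
  move: k1 k2.
  rewrite !DE flip_suc flip_pre ?tmapN ?tmapD ?tmapN.
  rewrite ?tmap_ll ?tmap_rr ?tmap_lr ?tmap_rl.
  all: do ?[exact: lmul_linear | exact: rmul_linear].
  rewrite (eq_tmapNl (rmul suc y \o lmul dot x) (lmul suc x \o rmul suc y));
    last by move=> a; rewrite /= /rmul /lmul tripleE.
  rewrite (eq_tmapNr (lmul pre y \o rmul dot x) (rmul pre x \o lmul pre y));
    last by move=> a; rewrite /= /rmul /lmul !tripleE.
  (* Each of [k1] and [k2] is solved for one of its terms in r; after substitution all terms
     cancel. *)
  move=> /(canRL (addrK _)) -> /(canRL (addrK _)) ->.
  by apply/matrixP => i j; rewrite !mxE; ring.
have k1 := congr1 (tmap id (rmul dot y)) (I1 x).
have k2 := congr1 (tmap (lmul suc y) id) (I1 x).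
(* In both flipped terms, left and right multiplications are reordered into the composites that
   occur in [k1] and [k2]. *)
have -> : tflip (tmap id (rmul pre x) (Dpre y)) =
    tmap (rmul pre x) (rmul dot y) (tflip r) +
    tmap (lmul suc y \o rmul pre x) id (tflip r).
  rewrite tflip_tmap // ?flip_pre ?tmapD ?tmap_ll ?tmap_lr.
  all: do ?[exact: lmul_linear | exact: rmul_linear].
  by congr (_ + _); apply: eq_tmapl => a; rewrite /= /rmul /lmul tripleE.
have -> : tflip (tmap (lmul dot x) id (Dpre y)) =
    tmap id (rmul dot y \o lmul dot x) (tflip r) +
    tmap (lmul suc y) (lmul dot x) (tflip r).
  rewrite tflip_tmap // ?flip_pre ?tmapD ?tmap_rr ?tmap_rl.
  all: do ?[exact: lmul_linear | exact: rmul_linear].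
  by congr (_ + _); apply: eq_tmapr => a; rewrite /= /rmul /lmul !tripleE.
move: k1 k2; rewrite /Dsuc /Dsuc_r -/dot ?(tmapN, tmapD).
rewrite ?(tmap_ll, tmap_rr, tmap_lr, tmap_rl).
all: do ?[exact: lmul_linear | exact: rmul_linear].
move=> /(canRL (addrK _)) -> /(canRL (addrK _)) ->.
by apply/matrixP => i j; rewrite !mxE; ring.
Qed.

End YangBaxter.
End AntiDendriform.

(** * The equivalence of the three conditions *)

Theorem theorem5p5 (k : fieldType) (A : vectType k) (suc pre : A -> A -> A)
    (hA : anti_dendriform suc pre) (r : tens A A)
    (hs : ad_invariant suc pre (r + tflip r)) :
  let dot := addop suc pre in
  let s := r + tflip r in
  let l_suc x u := - dual_act (rmul dot) x u in
  let r_suc x u := dual_act (lmul pre) x u in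
  let l_pre x u := dual_act (rmul suc) x u in
  let r_pre x u := - dual_act (lmul dot) x u in
  let l_dot x u := - dual_act (rmul pre) x u in
  let r_dot x u := - dual_act (lmul suc) x u in
  [/\ A_anti_dendriform suc pre (suc_s pre s) (pre_s suc pre s)
        l_suc r_suc l_pre r_pre,
      A_assoc_algebra dot (dot_s suc s) l_dot r_dot &
      [<-> AD_YBE suc pre r /\ quasi_triangular suc pre r;
           rRB_anti_dendriform suc pre (suc_s pre s) (pre_s suc pre s)
             l_suc r_suc l_pre r_pre (-1) (Tmap r);
           rRB_assoc dot (dot_s suc s) l_dot r_dot (-1) (Tmap r)]].
Proof.
move=> dot s l_suc r_suc l_pre r_pre l_dot r_dot.
have ss : tflip s = s := s_sym r.
split; [exact: A_anti_dendriform_s | exact: A_assoc_algebra_s | tfae].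
- move=> [ybe _]; apply/(rRB_anti_dendriformE hA) => z e.
  split; first exact: (AD_YBE_suc hA hs).
  exact: (AD_YBE_pre hA r).1.
- move=> /(rRB_anti_dendriformE hA) rb; apply/(rRB_assocE hA) => z e.
  have [e1 e2] := rb z e.
  (* The identity for the product is the sum of those for > and <. *)
  by rewrite -(desc_add hA) (linD (@Tmap_linear k A r)) -e1 -e2.
move=> /(rRB_assocE hA) /(AD_YBE_dot hA hs) ybe.
split=> //; split=> //; split=> //; first exact: (Dsuc_linear hA).
- exact: (Dpre_linear hA).
- exact: (dual_anti_dendriform hA hs ybe).
by move=> x y; case: (Delta_r_mul hA r x y); split=> //; exact: Delta_r_flip.
Qed.
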